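(* Let $A,B\in M_n(\mathbb{C})$, and let $M=[m_{pq}]_{p,q=0}^{n}$ be the $(n+1)\times(n+1)$ matrix of coefficients of the polynomial $$f(s,t)=\det(I-sA-tB)=\sum_{p,q=0}^{n}m_{pq}s^pt^q ,$$ where $m_{pq}=0$ whenever $p+q>n$. Then $\det(I-sA-tB)=\det(I-sA)\det(I-tB)$ for all scalars $s,t\in\mathbb{C}$ if and only if $\operatorname{rank}M=1$.
   Context: $M_n(\mathbb{C})$ is the set of $n\times n$ complex matrices and $I$ is the identity matrix. The rows and columns of $M$ are indexed by $p,q\in\{0,1,\ldots,n\}$, so that $f(s,t)=x^TMy$ with $x=(1,s,\ldots,s^n)^T$ and $y=(1,t,\ldots,t^n)^T$; in particular $m_{00}=1$. *)

(* Defs.v *)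
From HB Require Import structures.
From mathcomp Require Import all_boot all_order all_algebra.
From mathcomp Require Import reals complex.

Set Implicit Arguments.
Unset Strict Implicit.
Unset Printing Implicit Defensive.

Import Order.TTheory GRing.Theory Num.Theory.

Local Open Scope ring_scope.

Section PencilPolynomial.
Variables (F : comNzRingType) (n : nat).
Implicit Types A B : 'M[F]_n.

(* det (I - s A - t B) as a polynomial in two indeterminates: [t] is the      *)
(* outer indeterminate ['X] and [s] is the inner one, ['X%:P].  Hence         *)
(* [(pencil_poly A B)`_q`_p] is the coefficient of s^p t^q.                   *)
Definition pencil_poly A B : {poly {poly F}} :=
  \det (1%:M - 'X%:P *: map_mx (fun a : F => a%:P%:P) A
             - 'X *: map_mx (fun a : F => a%:P%:P) B).

Definition pencil_coef_mx A B : 'M[F]_n.+1 :=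
  \matrix_(p < n.+1, q < n.+1) (pencil_poly A B)`_q`_p.

Lemma horner_pencil_poly A B (s t : F) :
  (pencil_poly A B).[t%:P].[s] = \det (1%:M - s *: A - t *: B).
Proof.
rewrite /pencil_poly -/(horner_eval t%:P _) -/(horner_eval s _) -!det_map_mx.
congr (\det _); apply/matrixP => i j; rewrite !mxE /= /horner_eval.
rewrite !(hornerD, hornerN, hornerM, hornerC, hornerX).
by case: (i == j); rewrite ?mulr1n ?mulr0n !hornerC.
Qed.

Lemma pencil_poly_coef0 A B (p q : nat) :
  (n < p + q)%N -> (pencil_poly A B)`_q`_p = 0.
Proof.
pose D d (g : {poly {poly F}}) := forall p q, (d < p + q)%N -> g`_q`_p = 0.
have D1 : D 0%N 1.
  by move=> i [|j] h; rewrite coef1 /= ?coef0 // coef1; case: i h.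
have DM d e g h : D d g -> D e h -> D (d + e)%N (g * h).
  move=> Dg Dh i j ij; rewrite coefM coef_sum big1 // => k _.
  rewrite coefM big1 // => l _.
  have [dl|ld] := ltnP d (l + k); first by rewrite Dg ?mul0r.
  rewrite Dh ?mulr0 //.
  have kj : (k <= j)%N by rewrite -ltnS.
  have li : (l <= i)%N by rewrite -ltnS.
  rewrite -(ltn_add2l (l + k)) addnACA !subnKC //.
  by apply: leq_ltn_trans ij; rewrite leq_add2r.
have DZ d g (a : {poly {poly F}}) : D 0%N a -> D d g -> D d (a * g).
  by move=> ? ?; rewrite -[d]add0n; apply: DM.
have Dsign k : D 0%N ((-1) ^+ k).
  elim: k => [|k IH]; first by rewrite expr0.
  by rewrite exprS mulN1r => i j ij; rewrite !coefN IH ?oppr0.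
rewrite /pencil_poly /determinant => pq.
rewrite !coef_sum big1 // => u _; apply: (DZ n) pq => //.
rewrite -[X in D X](card_ord n) -sum1_card.
apply: (big_ind2 D) => // [d g e h|i _]; first exact: DM.
move=> {}p {}q {}pq; rewrite !mxE -!polyC1 -!polyCMn -polyCM.
rewrite !coefB coefXM !coefC.
case: q p pq => [|[|q]] [|[|p]] //= _.
all: by rewrite ?coefMC ?coefX ?coefC ?mul0r ?subrr ?subr0.
Qed.

Lemma pencil_coef_mxE A B (s t : F) :
  \det (1%:M - s *: A - t *: B) =
  \sum_(p < n.+1) \sum_(q < n.+1) pencil_coef_mx A B p q * s ^+ p * t ^+ q.
Proof.
rewrite -horner_pencil_poly (@horner_coef_wide _ n.+1 (pencil_poly A B)); last first.
  apply/leq_sizeP => q nq; apply/polyP => p.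
  by rewrite coef0 pencil_poly_coef0 // ltn_addl.
rewrite exchange_big horner_sum; apply: eq_bigr => q _.
rewrite -polyC_exp hornerM hornerC (@horner_coef_wide _ n.+1); last first.
  apply/leq_sizeP => p np; by rewrite pencil_poly_coef0 // ltn_addr.
by rewrite mulr_suml; apply: eq_bigr => p _; rewrite mxE.
Qed.

End PencilPolynomial.

(* Main.v *)
(* With [f(s,t) = x^T M y] and [m_00 = 1], the first column and the first row  *)
(* of [M] hold the coefficients of [f(s,0)] and [f(0,t)].  Both conditions are *)
(* thus equivalent to [m_pq = m_p0 * m_0q] for all [p], [q].                   *)
Require Import Defs.
From mathcomp Require Import all_boot all_order all_algebra.
From mathcomp Require Import reals complex.

Import GRing.Theory Num.Theory.

Local Open Scope ring_scope.

(** A matrix with corner entry 1 has rank one exactly when it is its first column times its first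
    row ([rank1_entryP]). Since f(s,0) and f(0,t) have that column and row as coefficients, their
    product has coefficients m_p0 m_0q ([det_pencil_mul]). Over an infinite domain, equal values at
    all (s,t) force equal coefficients ([bilinear_expr_eq0]). *)

Lemma rank1_entryP (F : fieldType) (m n : nat) (M : 'M[F]_(m.+1, n.+1)) :
  M 0 0 = 1 ->
  \rank M = 1%N <-> (forall p q, M p q = M p 0 * M 0 q).
Proof.
move=> M00; split=> [rM p q | defM].
  (* Full-rank factorization: at rank 1, [col_base M] is a column and [row_base M] a row. *)
  have [u [v defM]] : exists (u : 'cV_m.+1) (v : 'rV_n.+1), M = u *m v.
    move: (col_base M) (row_base M) (mulmx_base M); rewrite rM => u v <-.
    by exists u, v.
  have E i j : M i j = u i 0 * v 0 j by rewrite defM mxE big_ord1.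
  (* (u_p v_q)(u_0 v_0) = (u_p v_0)(u_0 v_q), where u_0 v_0 = 1. *)
  by rewrite -[LHS]mulr1 -M00 !E [u 0 0 * _]mulrC mulrACA [v 0 q * _]mulrC.
have -> : M = col 0 M *m row 0 M.
  by apply/matrixP=> p q; rewrite mxE big_ord1 !mxE.
(* The inner dimension bounds the rank by 1; the corner entry makes it nonzero. *)
apply/eqP; rewrite eqn_leq (leq_trans (mulmx_max_rank _ _)) // lt0n mxrank_eq0.
apply/eqP=> /matrixP/(_ 0 0)/eqP.
by rewrite !mxE big_ord1 !mxE M00 mulr1 oner_eq0.
Qed.

(** In characteristic zero the scalars 0, ..., n-1 are n distinct roots, too many for a nonzero
    polynomial of degree below n. *)
Lemma sum_expr_eq0 (F : numDomainType) (n : nat) (c : 'I_n -> F) :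
  (forall s, \sum_(i < n) c i * s ^+ i = 0) -> forall i, c i = 0.
Proof.
case: n c => [|n] c c0 i; first by case: i.
pose P := \poly_(i < n.+1) c (inord i).
have P0 s : P.[s] = 0.
  rewrite horner_poly -[RHS](c0 s).
  by apply: eq_bigr => j _; rewrite inord_val.
have -> : c i = P`_i by rewrite coef_poly ltn_ord inord_val.
have /eqP-> : P == 0; last by rewrite coef0.
pose rs := [seq (k%:R : F) | k <- iota 0 n.+1].
apply: contraT => /(@max_poly_roots _ _ rs).
rewrite size_map size_iota ltnNge size_poly; apply.
  by apply/allP=> s _; rewrite /root P0.
by rewrite map_inj_uniq ?iota_uniq //; apply: mulrIn; rewrite oner_eq0.
Qed.

Lemma bilinear_expr_eq0 (F : numDomainType) (m n : nat) (M : 'M[F]_(m, n)) :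
  (forall s t, \sum_(p < m) \sum_(q < n) M p q * s ^+ p * t ^+ q = 0) -> M = 0.
Proof.
move=> M0; apply/matrixP=> p q; rewrite mxE.
(* Row p lists the coefficients of a polynomial in t, whose value at each t is in turn the
   coefficient of s^p. *)
apply: (@sum_expr_eq0 _ _ (M p)) => t.
apply: (@sum_expr_eq0 _ _ (fun p => \sum_q M p q * t ^+ q)) => s.
rewrite -[RHS](M0 s t); apply: eq_bigr => i _.
by rewrite mulr_suml; apply: eq_bigr => j _; rewrite mulrAC.
Qed.

Lemma pencil_coef_mx00 (F : comNzRingType) (n : nat) (A B : 'M[F]_n) :
  pencil_coef_mx A B 0 0 = 1.
Proof.
have := horner_pencil_poly A B 0 0.
by rewrite polyC0 !horner_coef0 !scale0r !subr0 det1 mxE.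
Qed.

Lemma det_pencil_l (F : comNzRingType) (n : nat) (A B : 'M[F]_n) (s : F) :
  \det (1%:M - s *: A) = \sum_(p < n.+1) pencil_coef_mx A B p 0 * s ^+ p.
Proof.
have := pencil_coef_mxE A B s 0; rewrite scale0r subr0 => ->.
(* As 0^0 = 1, only the term q = 0 survives at t = 0. *)
apply: eq_bigr => p _; rewrite big_ord_recl mulr1 big1 ?addr0 // => q _.
by rewrite expr0n mulr0.
Qed.

Lemma det_pencil_r (F : comNzRingType) (n : nat) (A B : 'M[F]_n) (t : F) :
  \det (1%:M - t *: B) = \sum_(q < n.+1) pencil_coef_mx A B 0 q * t ^+ q.
Proof.
have := pencil_coef_mxE A B 0 t; rewrite scale0r subr0 => ->.
rewrite big_ord_recl [X in _ + X]big1 ?addr0.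
  by apply: eq_bigr => q _; rewrite mulr1.
by move=> p _; rewrite big1 // => q _; rewrite expr0n mulr0 mul0r.
Qed.

Lemma det_pencil_mul (F : comNzRingType) (n : nat) (A B : 'M[F]_n) (s t : F) :
  \det (1%:M - s *: A) * \det (1%:M - t *: B) =
  \sum_(p < n.+1) \sum_(q < n.+1)
    pencil_coef_mx A B p 0 * pencil_coef_mx A B 0 q * s ^+ p * t ^+ q.
Proof.
rewrite (det_pencil_l _ _ A B) (det_pencil_r _ _ A B) mulr_suml.
apply: eq_bigr => p _; rewrite mulr_sumr; apply: eq_bigr => q _.
by rewrite mulrACA mulrA.
Qed.

Theorem proposition6 (R : realType) (n : nat) (A B : 'M[R[i]]_n) :
  (forall s t : R[i],
     \det (1%:M - s *: A - t *: B) =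
     \det (1%:M - s *: A) * \det (1%:M - t *: B)) <->
  \rank (pencil_coef_mx A B) = 1%N.
Proof.
set M := pencil_coef_mx A B.
apply: iff_trans (iff_sym (rank1_entryP _ _ _ M (pencil_coef_mx00 _ _ A B))).
split=> [fM p q | defM s t]; last first.
  rewrite pencil_coef_mxE det_pencil_mul.
  by apply: eq_bigr => p _; apply: eq_bigr => q _; rewrite -defM.
(* The coefficient matrix of f(s,t) - f(s,0) f(0,t). *)
pose N := \matrix_(p < n.+1, q < n.+1) (M p q - M p 0 * M 0 q).
suff /matrixP/(_ p q)/eqP : N = 0 by rewrite !mxE subr_eq0 => /eqP.
apply: bilinear_expr_eq0 => s t; have /eqP := fM s t.
rewrite pencil_coef_mxE det_pencil_mul -subr_eq0 -sumrB => /eqP fM0.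
rewrite -[RHS]fM0; apply: eq_bigr => i _; rewrite -sumrB.
by apply: eq_bigr => j _; rewrite mxE !mulrBl.
Qed.
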